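(* Let $\mathcal{G}=(\mathcal{E},\mathcal{I},\Theta)$ be a GDatalog[$\Delta$] program, let $I$ be an input instance for $\mathcal{G}$, and let $T$ and $T'$ be two fair chase trees for $I$ w.r.t. $\mathcal{G}$. Then $\mu_T=\mu_{T'}$, i.e. the two probability measure spaces over the set $\Omega_{\mathcal{G}}(I)$ of possible outcomes have the same sample space, the same $\sigma$-algebra and the same probability measure.
   Context: Schemas, facts, instances. A schema is a collection of relation symbols $R$, each with an arity $\mathrm{arity}(R)\in\mathbb{N}$. A fact over a schema is an expression $R(c_1,\dots,c_n)$ with $R$ an $n$-ary symbol of the schema and $c_1,\dots,c_n\in\mathbb{R}$. An instance is a finite set of facts. An atom is $R(t_1,\dots,t_n)$ where each $t_i$ is a constant (real number) or a variable. Distributions. A parameterized numerical (discrete) distribution is a function $\delta:\Omega_\delta\times\mathbb{R}^k\to[0,1]$ with $\Omega_\delta\subseteq\mathbb{R}$ finite or countably infinite, such that $\sum_{o\in\Omega_\delta}\delta(o,\mathbf{p})=1$ for all $\mathbf{p}\in\mathbb{R}^k$; $k$ is denoted $\mathrm{pardim}(\delta)$. Write $\delta(o|\mathbf{p})$ for $\delta(o,\mathbf{p})$, and put $\delta(b|\mathbf{p})=0$ for $b\in\mathbb{R}\setminus\Omega_\delta$. GDatalog[$\Delta$]. Let $\Delta$ be a finite set of parameterized numerical distributions. A $\Delta$-term is $\delta[p_1,\dots,p_k]$ with $\delta\in\Delta$, $k=\mathrm{pardim}(\delta)$, each $p_i$ a variable or constant. A $\Delta$-atom is $R(t_1,\dots,t_n)$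 where exactly one $t_i$ is a $\Delta$-term and all other $t_j$ are constants or variables. A GDatalog[$\Delta$] program is $\mathcal{G}=(\mathcal{E},\mathcal{I},\Theta)$ with $\mathcal{E},\mathcal{I}$ disjoint schemas and $\Theta$ a finite set of rules $\forall\mathbf{x}(\psi(\mathbf{x})\leftarrow\varphi(\mathbf{x}))$, where $\varphi$ is a conjunction of atoms over $\mathcal{E}\cup\mathcal{I}$, $\psi$ is an atom or a $\Delta$-atom over $\mathcal{I}$, and every variable of $\mathbf{x}$ occurs in $\varphi$. An input instance for $\mathcal{G}$ is an instance over $\mathcal{E}$. Associated program $\widehat{\mathcal{G}}=(\mathcal{E},\mathcal{I}^\Delta,\Theta^\Delta)$. $\mathcal{I}^\Delta$ extends $\mathcal{I}$ with a new ''distributional'' relation symbol $R^\delta_i$ of arity $\mathrm{arity}(R)+\mathrm{pardim}(\delta)$ whenever some rule of $\Theta$ contains a $\Delta$-atom over $R$ with a term $\delta[\dots]$ in position $i$. $\Theta^\Delta$ consists of: (a) all rules of $\Theta$ without $\Delta$-terms; (b) the rule $\exists y\,R^\delta_i(\mathbf{t},y,\mathbf{t}',\mathbf{p})\leftarrow\varphi(\mathbf{x})$ for every rule $R(\mathbf{t},\delta[\mathbf{p}],\mathbf{t}')\leftarrow\varphi(\mathbf{x})$ of $\Theta$ with $\delta[\mathbf{p}]$ in position $i$ ($y$ is then in position $i$); (c) the rule $R(\mathbf{x})\leftarrow R^\delta_i(\mathbf{x},\mathbf{p})$ for every distributional symbol $R^\delta_i$. Possible outcomes. A solution of $I$ w.r.t.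 $\widehat{\mathcal{G}}$ is a possibly infinite set $J$ of facts over $\mathcal{E}\cup\mathcal{I}^\Delta$ with $I\subseteq J$ satisfying all rules of $\Theta^\Delta$ as first-order sentences; it is minimal if no proper subset of it is a solution. A possible outcome of $I$ w.r.t. $\mathcal{G}$ is a minimal solution $J$ such that $\delta(b|\mathbf{p})>0$ for every distributional fact $R^\delta_i(\mathbf{a},b,\mathbf{c},\mathbf{p})\in J$ with $b$ in position $i$. $\Omega_{\mathcal{G}}(I)$ is the set of all possible outcomes. Weights. The weight of a distributional fact $R^\delta_i(a_1,\dots,a_n,\mathbf{p})$ is $\delta(a_i|\mathbf{p})$; every other fact has weight $1$. For a finite set $F$ of facts, $\mathbf{P}(F)=\prod_{f\in F}\mathrm{weight}(f)$. Chase step. Let $J$ be an instance over $\mathcal{E}\cup\mathcal{I}^\Delta$, $\tau=(\psi(\mathbf{x})\leftarrow\varphi(\mathbf{x}))\in\Theta^\Delta$, and $\mathbf{a}$ a tuple of reals such that $\varphi(\mathbf{a})$ holds in $J$ and $\psi(\mathbf{a})$ does not (for an existential conclusion: no value of $y$ works). If $\psi$ is $\exists y\,R^\delta_i(\mathbf{t},y,\mathbf{t}',\mathbf{p})$ (terms instantiated by $\mathbf{a}$), let $\mathcal{J}$ be the set of all $J_b=J\cup\{R^\delta_i(\mathbf{t},b,\mathbf{t}',\mathbf{p})\}$ with $\delta(b|\mathbf{p})>0$, and $\pi(J_b)=\delta(b|\mathbf{p})$. Otherwise $\mathcal{J}=\{J\cup\{\psi(\mathbf{a})\}\}$ and $\pi$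 assigns $1$ to its element. Then $J\xrightarrow{\tau(\mathbf{a})}(\mathcal{J},\pi)$ is a valid chase step. Chase tree. A chase tree for $I$ w.r.t. $\mathcal{G}$ is a possibly infinite rooted tree whose nodes $v$ are labeled by instances $L(v)$ over $\mathcal{E}\cup\mathcal{I}^\Delta$ and whose edges are labeled by numbers in $[0,1]$, such that: the root is labeled $I$; for each non-leaf node labeled $J$, its children have pairwise distinct labels and, with $\mathcal{J}$ the set of these labels and $\pi$ the map sending each $J'\in\mathcal{J}$ to the label of the corresponding edge, $J\xrightarrow{\tau(\mathbf{a})}(\mathcal{J},\pi)$ is a valid chase step for some $\tau\in\Theta^\Delta$ and $\mathbf{a}$; for each leaf labeled $J$ there is no valid chase step from $J$. Fairness. A maximal path of $T$ is a path starting at the root that either ends in a leaf or is infinite; $\mathrm{paths}(T)$ is the set of maximal paths. A maximal path $P$ is fair if whenever the premise of a rule of $\Theta^\Delta$ is satisfied by some tuple in the label of some node on $P$, the conclusion is satisfied for the same tuple in the label of some node on $P$. $T$ is fair if all its maximal paths are fair. For $P\in\mathrm{paths}(T)$, $\cup P$ denotes the union of the labels of the nodes on $P$. The measure $\mu_T$. For a node $v$, the cylinder $C^T_v$ is the set of maximal paths containing $v$. By a classic result on Markov chains there is a unique probability measure space with sample space $\mathrm{paths}(T)$, with $\sigma$-algebra generated by all cylinders $C^T_v$, and with measure $\pi(C^T_v)=\mathbf{P}(L(v))$ for all nodes $v$. For a fair chase tree $T$, the map $P\mapsto\cup P$ is a bijection from $\mathrm{paths}(T)$ onto $\Omega_{\mathcal{G}}(I)$,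 and $\mu_T$ is the probability measure space over $\Omega_{\mathcal{G}}(I)$ obtained by transporting along this bijection (replacing each path $P$ by $\cup P$) the unique probability measure space on $\mathrm{paths}(T)$ whose $\sigma$-algebra is generated by all cylinders $C^T_v$ and whose measure satisfies $\pi(C^T_v)=\mathbf{P}(L(v))$ for all nodes $v$. *)

(* Defs.v *)
From HB Require Import structures.
From mathcomp Require Import all_boot all_order all_algebra finmap.
From mathcomp Require Import all_classical all_reals all_analysis.

Set Implicit Arguments.
Unset Strict Implicit.
Unset Printing Implicit Defensive.

Import Order.TTheory GRing.Theory Num.Theory.

Local Open Scope classical_set_scope.
Local Open Scope ring_scope.

(* A vocabulary of relation symbols with arities; a schema over it is a set   *)
(* of symbols.  An expression is a symbol applied to arguments: a fact when   *)
(* the arguments are reals, an atom when they are terms.                      *)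
Record signature := Signature { symbol :> choiceType; arity : symbol -> nat }.

Definition expr (S : signature) (A : choiceType) : choiceType :=
  {r : S & (arity r).-tuple A}.

Definition fact (R : realType) (S : signature) := expr S R.

Inductive term (R : realType) := Var of nat | Cst of R.
Arguments Var {R} _.

HB.instance Definition _ (R : realType) := gen_eqMixin (term R).
HB.instance Definition _ (R : realType) := gen_choiceMixin (term R).

Definition atom (R : realType) (S : signature) := expr S (term R).

Definition over (S : signature) (A : choiceType) (X : set S) : set (expr S A) :=
  [set e | X (tag e)].

Definition occurs (R : realType) (S : signature) (x : nat) (a : atom R S) :=
  Var x \in tval (tagged a).

(* Assignments are total on the variable names; only the values on the        *)
(* variables of the rule at hand matter.                                      *)
Definition teval (R : realType) (a : nat -> R) (t : term R) : R :=
  match t with Var x => a x | Cst c => c end.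

Definition inst (R : realType) (S : signature) (a : nat -> R) (e : atom R S) :
    fact R S :=
  Tagged (fun r : S => (arity r).-tuple R) [tuple of map (teval a) (tagged e)].

(* [pmass] is only meaningful on [psupp]; [dens] is its extension by 0. *)
Record pdist (R : realType) := PDist {
  pardim : nat;
  psupp : set R;
  pmass : R -> pardim.-tuple R -> R;
  psupp_countable : countable psupp;
  pmass_itv : forall o p, psupp o -> 0 <= pmass o p <= 1;
  pmass_sum : forall p, (\esum_(o in psupp) (pmass o p)%:E = 1)%E }.

HB.instance Definition _ (R : realType) := gen_eqMixin (pdist R).
HB.instance Definition _ (R : realType) := gen_choiceMixin (pdist R).

Definition dens (R : realType) (d : pdist R) (b : R) (p : (pardim d).-tuple R) :
    R :=
  if b \in psupp d then pmass b p else 0.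

(* The symbol R^delta_i, for i a position of R and delta in Delta. *)
Record dsymbol (R : realType) (S : signature) (Delta : {fset pdist R}) :=
  DSymbol { dbase : S; dpos : 'I_(arity dbase); ddist : Delta }.

HB.instance Definition _ R S Delta := gen_eqMixin (@dsymbol R S Delta).
HB.instance Definition _ R S Delta := gen_choiceMixin (@dsymbol R S Delta).

Definition dpardim (R : realType) (S : signature) (Delta : {fset pdist R})
    (s : dsymbol S Delta) : nat :=
  pardim (val (ddist s)).

Definition xsignature (R : realType) (S : signature) (Delta : {fset pdist R}) :
    signature :=
  @Signature (S + dsymbol S Delta)%type
    (fun s => match s with
              | inl r => arity r
              | inr s => (arity (dbase s) + dpardim s)%N
              end).

Definition lift_expr (R : realType) (S : signature) (Delta : {fset pdist R})
    (A : choiceType) (e : expr S A) : expr (xsignature S Delta) A :=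
  existT (fun s : xsignature S Delta => (arity s).-tuple A)
    (inl (tag e)) (tagged e).

Definition dexpr (R : realType) (S : signature) (Delta : {fset pdist R})
    (A : choiceType) (s : dsymbol S Delta)
    (args : (arity (dbase s) + dpardim s).-tuple A) :
    expr (xsignature S Delta) A :=
  existT (fun s : xsignature S Delta => (arity s).-tuple A) (inr s) args.

Arguments lift_expr {R S} Delta {A} e.

(* A Delta-atom R(t, delta[p], t') with delta[p] in position i: [dothers] is  *)
(* the tuple (t, t') of the remaining arguments, in order.                    *)
Record datom (R : realType) (S : signature) (Delta : {fset pdist R}) := DAtom {
  dsym : dsymbol S Delta;
  dothers : (arity (dbase dsym)).-1.-tuple (term R);
  dparams : (dpardim dsym).-tuple (term R) }.

Definition insert_at (A : Type) (n : nat) (i : 'I_n) (x : A)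
    (t : n.-1.-tuple A) : n.-tuple A :=
  [tuple if unlift i j is Some j' then tnth t j' else x | j < n].

(* The fact R^delta_i(t, b, t', p) with t, t', p instantiated by a. *)
Definition dinst (R : realType) (S : signature) (Delta : {fset pdist R})
    (a : nat -> R) (e : datom S Delta) (b : R) : fact R (xsignature S Delta) :=
  dexpr [tuple of
    insert_at (dpos (dsym e)) b [tuple of map (teval a) (dothers e)]
      ++ map (teval a) (dparams e)].

Inductive ghead (R : realType) (S : signature) (Delta : {fset pdist R}) :=
  | GAtom of atom R S
  | GDelta of datom S Delta.

Record grule (R : realType) (S : signature) (Delta : {fset pdist R}) :=
  GRule { ghd : ghead S Delta; gbody : seq (atom R S) }.

Definition ghead_symbol (R : realType) (S : signature) (Delta : {fset pdist R})
    (h : ghead S Delta) : S :=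
  match h with GAtom e => tag e | GDelta e => dbase (dsym e) end.

Definition ghead_occurs (R : realType) (S : signature) (Delta : {fset pdist R})
    (x : nat) (h : ghead S Delta) : Prop :=
  match h with
  | GAtom e => occurs x e
  | GDelta e => Var x \in tval (dothers e) \/ Var x \in tval (dparams e)
  end.

Record program (R : realType) (S : signature) (Delta : {fset pdist R}) :=
  Program {
    edb : set S;
    idb : set S;
    rules : set (grule S Delta);
    edb_idb_disjoint : edb `&` idb = set0;
    rules_finite : finite_set rules;
    rules_body : forall t e, rules t -> e \in gbody t ->
      over (edb `|` idb) e;
    rules_head : forall t, rules t -> idb (ghead_symbol (ghd t));
    rules_safe : forall t x, rules t -> ghead_occurs x (ghd t) ->
      exists2 e, e \in gbody t & occurs x e }.

Definition input_instance (R : realType) (S : signature)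
    (Delta : {fset pdist R}) (G : program S Delta) (I : set (fact R S)) : Prop :=
  finite_set I /\ I `<=` over (edb G).

(* The associated program: [XEx e] is the conclusion                          *)
(* exists y, R^delta_i(t, y, t', p), for e the Delta-atom R(t, delta[p], t'). *)
Inductive xhead (R : realType) (S : signature) (Delta : {fset pdist R}) :=
  | XAtom of atom R (xsignature S Delta)
  | XEx of datom S Delta.

Record xrule (R : realType) (S : signature) (Delta : {fset pdist R}) :=
  XRule { xhd : xhead S Delta; xbody : seq (atom R (xsignature S Delta)) }.

Definition dsymbol_of (R : realType) (S : signature) (Delta : {fset pdist R})
    (G : program S Delta) : set (dsymbol S Delta) :=
  [set s | exists t e, [/\ rules G t, ghd t = GDelta e & dsym e = s]].

(* The schema E u I^Delta. *)
Definition xschema (R : realType) (S : signature) (Delta : {fset pdist R})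
    (G : program S Delta) : set (xsignature S Delta) :=
  [set s | match s with
           | inl r => (edb G `|` idb G) r
           | inr s => dsymbol_of G s
           end].

Inductive xrules (R : realType) (S : signature) (Delta : {fset pdist R})
    (G : program S Delta) : xrule S Delta -> Prop :=
  | xrules_atom e body : rules G (GRule (GAtom Delta e) body) ->
      xrules G (XRule (XAtom (lift_expr Delta e)) (map (lift_expr Delta) body))
  | xrules_ex e body : rules G (GRule (GDelta e) body) ->
      xrules G (XRule (XEx e) (map (lift_expr Delta) body))
  | xrules_proj s : dsymbol_of G s ->
      xrules G (XRule
        (XAtom (lift_expr Delta
          (Tagged (fun r : S => (arity r).-tuple (term R))
             [tuple Var (val j) | j < arity (dbase s)])))
        [:: dexpr [tuple Var (val j) | j < arity (dbase s) + dpardim s]]).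

Definition body_holds (R : realType) (S : signature)
    (J : set (fact R S)) (a : nat -> R) (body : seq (atom R S)) : Prop :=
  forall e, e \in body -> J (inst a e).

Definition head_holds (R : realType) (S : signature) (Delta : {fset pdist R})
    (J : set (fact R (xsignature S Delta))) (a : nat -> R) (h : xhead S Delta) :
    Prop :=
  match h with
  | XAtom e => J (inst a e)
  | XEx e => exists b, J (dinst a e b)
  end.

Definition solution (R : realType) (S : signature) (Delta : {fset pdist R})
    (G : program S Delta) (I : set (fact R S))
    (J : set (fact R (xsignature S Delta))) : Prop :=
  [/\ J `<=` over (xschema G), lift_expr Delta @` I `<=` J &
      forall t a, xrules G t -> body_holds J a (xbody t) ->
        head_holds J a (xhd t)].

Definition minimal_solution (R : realType) (S : signature)
    (Delta : {fset pdist R}) (G : program S Delta) (I : set (fact R S))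
    (J : set (fact R (xsignature S Delta))) : Prop :=
  solution G I J /\ forall K, K `<` J -> ~ solution G I K.

Definition dweight (R : realType) (S : signature) (Delta : {fset pdist R})
    (s : dsymbol S Delta)
    (args : (arity (dbase s) + dpardim s).-tuple R) : R :=
  @dens R (val (ddist s)) (tnth args (lshift _ (dpos s)))
    [tuple tnth args (rshift (arity (dbase s)) j) | j < dpardim s].

Definition weight (R : realType) (S : signature) (Delta : {fset pdist R})
    (f : fact R (xsignature S Delta)) : R :=
  match f with
  | existT (inl _) _ => 1
  | existT (inr s) args => dweight args
  end.

Definition set_weight (R : realType) (S : signature) (Delta : {fset pdist R})
    (F : set (fact R (xsignature S Delta))) : R :=
  \big[*%R/1]_(f \in F) weight f.

Definition outcomes (R : realType) (S : signature) (Delta : {fset pdist R})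
    (G : program S Delta) (I : set (fact R S)) :
    set (set (fact R (xsignature S Delta))) :=
  [set J | minimal_solution G I J /\
     forall (s : dsymbol S Delta) args, J (dexpr args) ->
       0 < @dweight R S Delta s args].

Definition chase_step (R : realType) (S : signature) (Delta : {fset pdist R})
    (G : program S Delta) (J : set (fact R (xsignature S Delta)))
    (t : xrule S Delta) (a : nat -> R)
    (JJ : set (set (fact R (xsignature S Delta))))
    (q : set (fact R (xsignature S Delta)) -> R) : Prop :=
  [/\ xrules G t, body_holds J a (xbody t), ~ head_holds J a (xhd t) &
      match xhd t with
      | XAtom e =>
          JJ = [set J `|` [set inst a e]] /\ q (J `|` [set inst a e]) = 1
      | XEx e =>
          let delta b :=
            @dens R (val (ddist (dsym e))) b
              [tuple of map (teval a) (dparams e)] in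
          JJ = [set J `|` [set dinst a e b] | b in [set b | 0 < delta b]] /\
          forall b, 0 < delta b -> q (J `|` [set dinst a e b]) = delta b
      end].

(* A rooted tree given by its parent function: every node reaches the root    *)
(* in finitely many steps.                                                    *)
Record rtree := RTree {
  node : Type;
  root : node;
  parent : node -> option node;
  parent_root : forall v, parent v = None <-> v = root;
  root_reached : forall v, exists n, iter n (obind parent) (Some v) = Some root }.

Definition child (T : rtree) (v u : node T) : Prop := parent u = Some v.

Definition leaf (T : rtree) (v : node T) : Prop := forall u, ~ child v u.

(* Maximal paths as sequences of nodes; [None] continues a path after a leaf. *)
Definition is_maxpath (T : rtree) (p : nat -> option (node T)) : Prop :=
  p 0%N = Some (root T) /\
  forall n, match p n with
            | Some v => (leaf v /\ p n.+1 = None) \/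
                        (exists2 u, child v u & p n.+1 = Some u)
            | None => p n.+1 = None
            end.

Record maxpath (T : rtree) :=
  MaxPath { pseq :> nat -> option (node T); pseqP : is_maxpath pseq }.

Definition on_path (T : rtree) (P : maxpath T) (v : node T) : Prop :=
  exists n, P n = Some v.

HB.instance Definition _ (T : rtree) := gen_eqMixin (maxpath T).
HB.instance Definition _ (T : rtree) := gen_choiceMixin (maxpath T).

Definition some_child (T : rtree) (v : node T) : option (node T) :=
  if pselect (exists u, child v u) is left h then Some (projT1 (cid h)) else None.

Lemma greedyP (T : rtree) :
  is_maxpath (fun n => iter n (obind (@some_child T)) (Some (root T))).
Proof.
split=> // n; rewrite iterS.
case: (iter n _ _) => [v|] //=; rewrite /some_child.
case: pselect => [h|h]; last by left; split=> // u vu; apply: h; exists u.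
by right; exists (projT1 (cid h)) => //; case: cid.
Qed.

HB.instance Definition _ (T : rtree) :=
  isPointed.Build (maxpath T) (MaxPath (greedyP T)).

Definition cylinder (T : rtree) (v : node T) : set (maxpath T) :=
  [set P | on_path P v].

Definition path_space (T : rtree) :=
  g_sigma_algebraType (range (@cylinder T)).

(* [elabel v] labels the edge from the parent of v to v. *)
Record chase_tree (R : realType) (S : signature) (Delta : {fset pdist R})
    (G : program S Delta) (I : set (fact R S)) := ChaseTree {
  tree :> rtree;
  label : node tree -> set (fact R (xsignature S Delta));
  elabel : node tree -> R;
  label_finite : forall v, finite_set (label v);
  label_schema : forall v, label v `<=` over (xschema G);
  elabel_itv : forall v, v <> root tree -> 0 <= elabel v <= 1;
  label_root : label (root tree) = lift_expr Delta @` I;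
  label_children : forall v u u', child v u -> child v u' ->
    label u = label u' -> u = u';
  chase_inner : forall v, ~ leaf v -> exists t a q,
    chase_step G (label v) t a (label @` child v) q /\
    forall u, child v u -> q (label u) = elabel u;
  chase_leaf : forall v, leaf v ->
    forall t a JJ q, ~ chase_step G (label v) t a JJ q }.

Definition fair_path (R : realType) (S : signature) (Delta : {fset pdist R})
    (G : program S Delta) (I : set (fact R S)) (T : chase_tree G I)
    (P : maxpath T) : Prop :=
  forall t a, xrules G t ->
    (exists2 v, on_path P v & body_holds (label v) a (xbody t)) ->
    exists2 v, on_path P v & head_holds (label v) a (xhd t).

Definition fair (R : realType) (S : signature) (Delta : {fset pdist R})
    (G : program S Delta) (I : set (fact R S)) (T : chase_tree G I) : Prop :=
  forall P : maxpath T, fair_path P.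

Definition path_union (R : realType) (S : signature) (Delta : {fset pdist R})
    (G : program S Delta) (I : set (fact R S)) (T : chase_tree G I)
    (P : maxpath T) : set (fact R (xsignature S Delta)) :=
  \bigcup_(v in on_path P) label v.

(* The defining property of the measure on paths(T). *)
Definition is_path_measure (R : realType) (S : signature)
    (Delta : {fset pdist R}) (G : program S Delta) (I : set (fact R S))
    (T : chase_tree G I) (pi : probability (path_space T) R) : Prop :=
  forall v : node T, pi (cylinder v) = (set_weight (label v))%:E.

(* Measure spaces carried by a set of elements of X; [mmeas] is only          *)
(* meaningful on [mevents].                                                   *)
Record mspace (R : realType) (X : Type) := MSpace {
  msample : set X;
  mevents : set (set X);
  mmeas : set X -> \bar R }.

Definition same_mspace (R : realType) (X : Type) (M N : mspace R X) : Prop :=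
  [/\ msample M = msample N, mevents M = mevents N &
      forall A, mevents M A -> mmeas M A = mmeas N A].

(* The space mu_T: each path P is replaced by its union.  On the image of a   *)
(* measurable set of paths, [path_union @^-1`] recovers that set when T is    *)
(* fair, as [path_union] is then injective.                                   *)
Definition chase_measure (R : realType) (S : signature)
    (Delta : {fset pdist R}) (G : program S Delta) (I : set (fact R S))
    (T : chase_tree G I) (pi : probability (path_space T) R) :
    mspace R (set (fact R (xsignature S Delta))) :=
  {| msample := range (@path_union R S Delta G I T);
     mevents := [set @path_union R S Delta G I T @` A
                   | A in (@measurable _ (path_space T))];
     mmeas := fun B => pi (@path_union R S Delta G I T @^-1` B) |}.

(* Main.v *)
Require Import Defs.
From mathcomp Require Import all_boot all_order all_algebra finmap.
From mathcomp Require Import all_classical all_reals all_analysis.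

Set Implicit Arguments.
Unset Strict Implicit.
Unset Printing Implicit Defensive.

Import Order.TTheory GRing.Theory Num.Theory.

Local Open Scope classical_set_scope.
Local Open Scope ring_scope.

(* In a chase tree the node v lies on a maximal path P iff its label is a subset
   of the union of P, since sampled values are functionally determined; hence
   P |-> union of P is injective, and under fairness its image is the set of
   possible outcomes.  The cylinders of T thus become the sets of outcomes that
   contain the label of a node of T, which are measurable for T' as well.

   For the measures, put F := label v, with v a node of T.  By backward
   induction over the levels of T', a chase in T' which has reached J derives
   all of F with probability at most P(F u J) / P(J), so F has probability at
   most P(F) under mu_T'.  Hence mu_T' <= mu_T on the cylinders of T.  As both
   sides are additive over the children of a node and have total mass 1,
   equality propagates from the root downwards, and cylinders form a
   pi-system. *)

(** * Facts and chase steps *)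

Lemma dens_ge0 (R : realType) (d : pdist R) b p : 0 <= @dens R d b p.
Proof.
rewrite /dens; case: ifPn => // /set_mem sb.
by case/andP: (pmass_itv p sb).
Qed.

Lemma dens_gt0_supp (R : realType) (d : pdist R) b p :
  0 < @dens R d b p -> psupp d b.
Proof. by rewrite /dens; case: ifPn => [/set_mem|_]; rewrite ?ltxx. Qed.

(** Points of mass zero contribute nothing, so this is the total mass of [d] over its support. *)
Lemma esum_dens (R : realType) (d : pdist R) p :
  (\esum_(b in [set b | (0 < @dens R d b p)%R]) (@dens R d b p)%:E = 1)%E.
Proof.
rewrite -(pmass_sum p) [RHS]esum_mkcond esum_mkcond; apply: eq_esum => b _.
rewrite /dens; case: (asboolP (psupp d b)) => [sb|nsb].
  rewrite (mem_set sb); case: ifPn => // /negP; rewrite inE /=.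
  rewrite mem_set // => /negP; rewrite -leNgt => h.
  congr (_%:E); apply/esym/le_anti; rewrite h.
  by case/andP: (pmass_itv p sb) => ->.
by rewrite (memNset nsb); case: ifP.
Qed.

Section facts.
Context (R : realType) (S : signature) (Delta : {fset pdist R}).
Implicit Types (e : datom S Delta) (J K : set (fact R (xsignature S Delta))).

Lemma insert_at_inj (A : Type) n (i : 'I_n) (x y : A) (t u : n.-1.-tuple A) :
  insert_at i x t = insert_at i y u -> x = y /\ t = u.
Proof.
move=> eq; split.
  have := congr1 (fun z : n.-tuple A => tnth z i) eq.
  by rewrite !tnth_mktuple unlift_none.
apply: eq_from_tnth => j.
have := congr1 (fun z : n.-tuple A => tnth z (lift i j)) eq.
by rewrite !tnth_mktuple liftK.
Qed.

Lemma insert_at_id (A : Type) n (i : 'I_n) (x : A) (t : n.-1.-tuple A) :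
  tnth (insert_at i x t) i = x.
Proof. by rewrite tnth_mktuple unlift_none. Qed.

(** Generalizes [dinst] to argument tuples indexed by a free symbol [s], so that an equation between
    symbols can be destructed; in [dinst] the symbol is the projection [dsym e]. *)
Let dfact (s : dsymbol S Delta) (o : (arity (dbase s)).-1.-tuple R)
    (p : (dpardim s).-tuple R) b : fact R (xsignature S Delta) :=
  @dexpr R S Delta R s [tuple of insert_at (dpos s) b o ++ p].

Let dfact_inj s o p b s' o' p' b' :
  @dfact s o p b = @dfact s' o' p' b' ->
  b = b' /\ @dfact s o p =1 @dfact s' o' p'.
Proof.
move=> eq; have ss : s = s' by case: (congr1 (@tag _ _) eq).
case: s' / ss o' p' eq => o' p' eq.
have /eqP := congr1 (@tval _ _) (eq_from_Tagged eq).
rewrite /= eqseq_cat ?size_tuple // => /andP[/eqP eo /eqP ep].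
have {}ep : p = p' by exact: val_inj.
have {eo} : insert_at (dpos s) b o = insert_at (dpos s) b' o' by exact: val_inj.
move=> eo; have [-> ->] := insert_at_inj eo; rewrite ep; split=> //.
Qed.

Lemma dinst_inj a a' e e' b b' :
  dinst a e b = dinst a' e' b' -> b = b' /\ dinst a e =1 dinst a' e'.
Proof. exact: dfact_inj. Qed.

Lemma dinstNlift a e b (g : fact R S) : dinst a e b <> lift_expr Delta g.
Proof. by move=> /(congr1 (@tag _ _)). Qed.

Lemma weight_lift (g : fact R S) : weight (lift_expr Delta g) = 1.
Proof. by []. Qed.

Lemma weight_dinst a e b :
  weight (dinst a e b) =
  @dens R (val (ddist (dsym e))) b [tuple of map (teval a) (dparams e)].
Proof.
rewrite /dinst /= /dweight tnth_lshift insert_at_id; congr dens.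
by apply: eq_from_tnth => j; rewrite tnth_mktuple tnth_rshift.
Qed.

Lemma weight_ge0 (f : fact R (xsignature S Delta)) : 0 <= weight f.
Proof. by case: f => -[r|s] args //=; exact: dens_ge0. Qed.

(* Sampled values are functionally determined by the other arguments. *)
Definition functional J := forall a e b b',
  J (dinst a e b) -> J (dinst a e b') -> b = b'.

Lemma functionalS J K : J `<=` K -> functional K -> functional J.
Proof. by move=> JK fK a e b b' /JK h /JK; apply: fK. Qed.

Lemma functionalU_lift J (g : fact R S) : functional J ->
  functional (J `|` [set lift_expr Delta g]).
Proof.
by move=> fJ a e b b' [h|/dinstNlift//] [h'|/dinstNlift//]; apply: fJ h h'.
Qed.

Lemma functionalU_dinst J a e b : functional J ->
  (forall c, ~ J (dinst a e c)) -> functional (J `|` [set dinst a e b]).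
Proof.
move=> fJ nJ a' e' c c' [h|/= h] [h'|/= h'].
- exact: fJ h h'.
- by have [_ eqd] := dinst_inj h'; case: (nJ c); rewrite -eqd.
- by have [_ eqd] := dinst_inj h; case: (nJ c'); rewrite -eqd.
- by have [-> _] := dinst_inj h; have [-> _] := dinst_inj h'.
Qed.

Lemma set_weightU1 J f : finite_set J -> ~ J f ->
  set_weight (J `|` [set f]) = set_weight J * weight f.
Proof.
move=> finJ nJf; rewrite /set_weight fsbigU//=; last first.
  by move=> g [Jg /= gf]; rewrite gf in Jg.
by rewrite fsbig_set1.
Qed.

Lemma set_weight_ge0 J : 0 <= set_weight J.
Proof.
rewrite /set_weight; apply: (big_ind (fun x => 0 <= x)) => //.
- by move=> x y; exact: mulr_ge0.
- by move=> f _; exact: weight_ge0.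
Qed.

Definition rules_closed (G : program S Delta) K := forall t a,
  xrules G t -> body_holds K a (xbody t) -> head_holds K a (xhd t).

(* A uniform description of both kinds of chase steps from [J], for which [JJ]
   is the set of resulting instances: one of the facts [f b], b in B, is added.
   A step that is not probabilistic has a singleton for [B] and a constant [f]. *)
Record branching (G : program S Delta) J
    (JJ : set (set (fact R (xsignature S Delta))))
    (B : set R) (f : R -> fact R (xsignature S Delta)) : Prop := Branching {
  branch_countable : countable B;
  branch_labels : JJ = [set J `|` [set f b] | b in B];
  branch_new : forall b, ~ J (f b);
  branch_gt0 : forall b, B b -> 0 < weight (f b);
  branch_all : forall b, 0 < weight (f b) -> exists2 b', B b' & f b' = f b;
  branch_sum : (\esum_(b in B) (weight (f b))%:E = 1)%E;
  branch_inj : forall b b', B b -> B b' -> f b = f b' -> b = b';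
  branch_closed : forall K, rules_closed G K -> J `<=` K -> exists b, K (f b);
  branch_unique : forall K b b', functional K -> K (f b) -> K (f b') ->
    f b = f b';
  branch_functional : forall K b, functional K -> (forall c, ~ K (f c)) ->
    functional (K `|` [set f b]) }.

(** Covers the rules whose conclusion is an atom: the added fact is not distributional, hence has
    weight 1. The index 0 is an arbitrary choice. *)
Lemma branching_lift (G : program S Delta) J (g : fact R S) :
    ~ J (lift_expr Delta g) ->
    (forall K, rules_closed G K -> J `<=` K -> K (lift_expr Delta g)) ->
  branching G J [set J `|` [set lift_expr Delta g]]
    [set 0] (fun _ => lift_expr Delta g).
Proof.
move=> nJ cJ; split=> //.
- by rewrite image_set1.
- by move=> b; exists 0.
- by rewrite esum_set1 weight_lift.
- by move=> b b' -> ->.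
- by move=> K cK JK; exists 0; exact: cJ.
- by move=> K _ fK _; exact: functionalU_lift.
Qed.

Lemma chase_step_branching (G : program S Delta) J t a JJ q :
  chase_step G J t a JJ q -> exists B f, branching G J JJ B f.
Proof.
case=> tG bJ nhJ.
have body K : J `<=` K -> body_holds K a (xbody t) by move=> JK e /bJ/JK.
have hd K : rules_closed G K -> J `<=` K -> head_holds K a (xhd t).
  by move=> cK JK; apply: cK => //; exact: body.
case: tG nhJ hd {bJ body} => /= [e bd _ nhJ hd [-> _]|
    e bd _ nhJ hd [-> _]|s _ nhJ hd [-> _]].
- by do 2 eexists; exact: (@branching_lift G J (inst a e)).
- pose p := [tuple of map (teval a) (dparams e)].
  (* The branches are the values of positive density only; [esum_dens] shows that they carry the
     whole mass. *)
  exists [set b | 0 < @dens R (val (ddist (dsym e))) b p], (dinst a e); split.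
  + apply: sub_countable (psupp_countable (val (ddist (dsym e)))).
    by apply: subset_card_le => b /dens_gt0_supp.
  + by [].
  + by move=> b Jb; apply: nhJ; exists b.
  + by move=> b; rewrite weight_dinst.
  + by move=> b; rewrite weight_dinst => b0; exists b.
  + under eq_esum do rewrite weight_dinst.
    exact: esum_dens.
  + by move=> b b' _ _ /dinst_inj[].
  + exact: hd.
  + by move=> K b b' fK Kb Kb'; rewrite (fK _ _ _ _ Kb Kb').
  + by move=> K b fK nK; exact: functionalU_dinst.
(* A projection rule also derives a fact over the original symbols, and [inst] commutes with
   [lift_expr] by conversion. *)
- set g := Tagged _ _ in nhJ hd *.
  by do 2 eexists; exact: (@branching_lift G J (inst a g)).
Qed.

End facts.

(** * Trees and possible outcomes *)

Section trees.
Context (T : rtree).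
Implicit Types (u v w : node T) (P Q : maxpath T).

Lemma tree_ind (C : node T -> Prop) :
  C (Defs.root T) -> (forall v u, child v u -> C v -> C u) -> forall v, C v.
Proof.
move=> C0 CS v; have [n] := root_reached v.
elim: n v => [|n IHn] v; first by case=> ->.
rewrite iterSr /=; case vw : (parent v) => [w|] /=.
  by move=> /IHn; exact: CS.
by have /parent_root -> := vw.
Qed.

Definition depth v := projT1 (cid (root_reached v)).

Lemma parent_rootN : parent (Defs.root T) = None.
Proof. exact/parent_root. Qed.

Lemma iter_parent_root n :
  iter n (obind (@parent T)) (Some (Defs.root T)) = Some (Defs.root T) ->
  n = 0%N.
Proof.
case: n => // n; rewrite iterSr /= parent_rootN.
by have -> : iter n (obind (@parent T)) None = None by elim: n => //= n ->.
Qed.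

(** The root has no parent, so the number of steps to it is unique and the choice made in [depth] is
    immaterial. *)
Lemma depth_eq v n :
  iter n (obind (@parent T)) (Some v) = Some (Defs.root T) -> depth v = n.
Proof.
rewrite /depth; case: cid => m /= vm vn.
wlog mn : m n vm vn / (m <= n)%N.
  by move=> wl; case: (leqP m n) => [|/ltnW] /wl->.
move: vn; rewrite -(subnK mn) iterD vm => /iter_parent_root ->.
by rewrite add0n.
Qed.

Lemma depth_root : depth (Defs.root T) = 0%N.
Proof. exact: depth_eq. Qed.

Lemma depth_child v u : child v u -> depth u = (depth v).+1.
Proof.
by move=> vu; apply: depth_eq; rewrite iterSr /= vu /depth; case: cid.
Qed.

Lemma path_root P : P 0%N = Some (Defs.root T).
Proof. by case: (pseqP P). Qed.

Lemma path_child P n v u : P n = Some v -> P n.+1 = Some u -> child v u.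
Proof.
move=> Pv Pu; have [_ /(_ n)] := pseqP P.
by rewrite Pv Pu => -[[]//|[u' vu' [->]]].
Qed.

Lemma path_None P n : P n = None -> P n.+1 = None.
Proof. by move=> Pn; have [_ /(_ n)] := pseqP P; rewrite Pn. Qed.

Lemma path_depth P n v : P n = Some v -> depth v = n.
Proof.
elim: n v => [|n IHn] v Pv.
  by move: Pv; rewrite path_root => -[<-]; exact: depth_root.
case Pn : (P n) => [w|]; last by rewrite (path_None Pn) in Pv.
by rewrite (depth_child (path_child Pn Pv)) (IHn _ Pn).
Qed.

(** A path starts at the root and descends one level per index, so its node at index [n] has depth
    [n]. *)
Lemma on_pathP P v : on_path P v <-> P (depth v) = Some v.
Proof.
split=> [[n Pn]|Pv]; last by exists (depth v).
by rewrite (path_depth Pn).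
Qed.

Lemma on_path_root P : on_path P (Defs.root T).
Proof. by exists 0%N; exact: path_root. Qed.

Lemma on_path_depth_inj P u v :
  on_path P u -> on_path P v -> depth u = depth v -> u = v.
Proof.
by move=> /on_pathP Pu /on_pathP Pv uv; move: Pu; rewrite uv Pv => -[].
Qed.

Lemma on_path_child_inj P v u u' : child v u -> child v u' ->
  on_path P u -> on_path P u' -> u = u'.
Proof.
move=> vu vu' Pu Pu'; apply: on_path_depth_inj Pu Pu' _.
by rewrite (depth_child vu) (depth_child vu').
Qed.

Lemma on_path_parent P v u : child v u -> on_path P u -> on_path P v.
Proof.
move=> vu /on_pathP; rewrite (depth_child vu) => Pu.
case Pn : (P (depth v)) => [w|]; last by rewrite (path_None Pn) in Pu.
exists (depth v); rewrite Pn; congr Some.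
by have := path_child Pn Pu; rewrite /child vu => -[].
Qed.

Lemma on_path_next P v : on_path P v -> ~ leaf v ->
  exists2 u, child v u & on_path P u.
Proof.
case=> n Pn nl; have [_ /(_ n)] := pseqP P; rewrite Pn => -[[]//|[u vu Pu]].
by exists u => //; exists n.+1.
Qed.

Lemma nonleaf v u : child v u -> ~ leaf v.
Proof. by move=> vu /(_ u). Qed.

Lemma maxpath_eq P Q : pseq P =1 pseq Q -> P = Q.
Proof.
case: P Q => [p pP] [q qP] /= /funext pq; case: q / pq qP => qP.
by congr MaxPath; exact: Prop_irrelevance.
Qed.

Lemma cylinder_root : cylinder (Defs.root T) = setT.
Proof. by apply/seteqP; split => // P _; exact: on_path_root. Qed.

Lemma cylinder_children v : ~ leaf v ->
  cylinder v = \bigcup_(u in child v) cylinder u.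
Proof.
move=> nl; apply/seteqP; split => [P /on_path_next/(_ nl)[u vu Pu]|P [u vu Pu]].
  by exists u.
exact: on_path_parent vu Pu.
Qed.

(** A path has at most one node of each depth and contains all ancestors of its nodes; so [u] is [v]
    or an ancestor of [v]. *)
Lemma cylinder_sub P u v : on_path P u -> on_path P v ->
  (depth u <= depth v)%N -> cylinder v `<=` cylinder u.
Proof.
move=> Pu; elim/tree_ind: v => [|v w vw IHv] Pv.
  rewrite depth_root leqn0 => /eqP du.
  by rewrite (on_path_depth_inj Pu (on_path_root P)) ?depth_root.
rewrite leq_eqVlt => /orP[/eqP uv|].
  by rewrite (on_path_depth_inj Pu Pv uv).
rewrite (depth_child vw) ltnS => uv Q /(on_path_parent vw).
by apply: IHv => //; exact: on_path_parent vw Pv.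
Qed.

(** Cylinders are nested or disjoint; together with the empty set they form a pi-system. *)
Lemma cylinderI u v :
  [\/ cylinder u `&` cylinder v = set0, cylinder u `&` cylinder v = cylinder u
    | cylinder u `&` cylinder v = cylinder v].
Proof.
have [uv|/set0P[P [Pu Pv]]] := eqVneq (cylinder u `&` cylinder v) set0.
  by constructor 1.
case: (leqP (depth u) (depth v)) => [uv|/ltnW vu].
  by constructor 3; apply/setIidPr; exact: cylinder_sub Pu Pv uv.
by constructor 2; apply/setIidPl; exact: cylinder_sub Pv Pu vu.
Qed.

End trees.
Arguments tree_ind {T}.

(** * Chase paths and their unions *)

Section chase.
Context (R : realType) (S : signature) (Delta : {fset pdist R}).
Context (G : program S Delta) (I : set (fact R S)).

Section one_tree.
Variable T : chase_tree G I.
Implicit Types (u v w : node T) (P Q : maxpath T).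

Notation L := (@label R S Delta G I T).
Notation U := (@path_union R S Delta G I T).

Lemma nonleaf_branching v : ~ leaf v -> exists B f,
  branching G (label v) (L @` child v) B f.
Proof.
by move=> /chase_inner[t [a [q [st _]]]]; exact: chase_step_branching st.
Qed.

Lemma child_label v u : child v u -> exists B f b,
  [/\ branching G (label v) (L @` child v) B f, B b
    & label u = label v `|` [set f b]].
Proof.
move=> vu; have [B [f br]] := nonleaf_branching (nonleaf vu).
have [b Bb ub] : [set label v `|` [set f b] | b in B] (label u).
  by rewrite -(branch_labels br); exists u.
by exists B, f, b; split.
Qed.

Lemma label_sub v u : child v u -> label v `<=` label u.
Proof. by move=> /child_label[B [f [b [_ _ ->]]]] x; left. Qed.

(** A chase step samples a value only if none is present yet for the same remaining arguments. *)
Lemma label_functional v : functional (label v).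
Proof.
elim/(@tree_ind T): v => [|v u vu IHv].
  by rewrite label_root => a e b b' [g _] /esym/dinstNlift.
have [B [f [b [br Bb ->]]]] := child_label vu.
by apply: (branch_functional br) => // c; exact: branch_new br c.
Qed.

Lemma label_weight v f : label v f -> 0 < weight f.
Proof.
elim/(@tree_ind T): v f => [|v u vu IHv] f.
  by rewrite label_root => -[g _ <-]; rewrite weight_lift.
have [B [h [b [br Bb ->]]]] := child_label vu.
by case=> [/IHv//|/= ->]; exact: (branch_gt0 br).
Qed.

Lemma label_path P v w : on_path P v -> on_path P w ->
  (depth v <= depth w)%N -> label v `<=` label w.
Proof.
move=> Pv; elim/(@tree_ind T): w => [|w u wu IHw] Pu.
  rewrite depth_root leqn0 => /eqP dv.
  by rewrite (on_path_depth_inj Pv (on_path_root P)) ?depth_root.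
rewrite leq_eqVlt => /orP[/eqP vu|].
  by rewrite (on_path_depth_inj Pv Pu vu).
rewrite (depth_child wu) ltnS => vw f fv; apply: (label_sub wu).
by apply: IHw fv => //; exact: on_path_parent wu Pu.
Qed.

Lemma label_path_union P v : on_path P v -> label v `<=` U P.
Proof. by move=> Pv f fv; exists v. Qed.

(** Labels increase along a path, so finitely many facts of the union occur together in a single
    label. *)
Lemma path_union_seq P (s : seq (fact R (xsignature S Delta))) :
  (forall f, f \in s -> U P f) ->
  exists2 v, on_path P v & forall f, f \in s -> label v f.
Proof.
elim: s => [|g s IHs] h.
  by exists (Defs.root T) => //; exact: on_path_root.
have [|v Pv vs] := IHs; first by move=> f fs; apply: h; rewrite inE fs orbT.
have [|w Pw wg] := h g; first by rewrite inE eqxx.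
case: (leqP (depth v) (depth w)) => [vw|/ltnW wv].
  exists w => // f; rewrite inE => /orP[/eqP->//|/vs].
  exact: label_path Pv Pw vw _.
exists v => // f; rewrite inE => /orP[/eqP->|/vs//].
exact: label_path Pw Pv wv _ wg.
Qed.

Lemma path_union_functional P : functional (U P).
Proof.
move=> a e b b' h h'; have [|v Pv vs] :=
    @path_union_seq P [:: dinst a e b; dinst a e b'].
  by move=> f; rewrite !inE => /orP[]/eqP->.
by apply: (@label_functional v a e); apply: vs; rewrite !inE eqxx ?orbT.
Qed.

(** The path leaves [v] through some child [w]. The facts added at [u] and at [w] both lie in the
    functional set [U P], so they coincide, and siblings with the same label are equal. *)
Lemma on_path_child P v u : on_path P v -> child v u -> label u `<=` U P ->
  on_path P u.
Proof.
move=> Pv vu uP; have [w vw Pw] := on_path_next Pv (nonleaf vu).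
have [B [f [b [br Bb ub]]]] := child_label vu.
have : (L @` child v) (label w) by exists w.
rewrite (branch_labels br) => -[b' Bb' wb'].
suff -> : u = w by [].
apply: label_children vu vw _; rewrite ub -wb'; congr (_ `|` [set _]).
apply: (branch_unique br) (@path_union_functional P) _ _.
  by apply: uP; rewrite ub; right.
by apply: (label_path_union Pw); rewrite -wb'; right.
Qed.

Lemma on_pathE P v : on_path P v <-> label v `<=` U P.
Proof.
split; first exact: label_path_union.
elim/(@tree_ind T): v => [_|v u vu IHv uP]; first exact: on_path_root.
apply: (on_path_child _ vu uP); apply: IHv.
exact: subset_trans (label_sub vu) uP.
Qed.

Lemma path_union_inj : injective U.
Proof.
move=> P Q PQ; apply: maxpath_eq => n.
have opE v : on_path P v <-> on_path Q v by rewrite !on_pathE PQ.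
case Pn : (P n) => [v|].
  have /on_pathP : on_path Q v by apply/opE; exists n.
  by rewrite (path_depth Pn).
case Qn : (Q n) => [v|] //.
have /on_pathP : on_path P v by apply/opE; exists n.
by rewrite (path_depth Qn) Pn.
Qed.

Lemma closed_path_union P : fair T -> rules_closed G (U P).
Proof.
move=> fT t a tG bP.
have [|v Pv vb] := @path_union_seq P (map (inst a) (xbody t)).
  by move=> _ /mapP[e eb ->]; exact: bP.
have [|w Pw] := fT P t a tG.
  by exists v => // e eb; apply: vb; exact: map_f.
case: (xhd t) => [e|e] /=; first exact: label_path_union.
by case=> b wb; exists b; exact: label_path_union wb.
Qed.

Lemma path_union_solution P : fair T -> solution G I (U P).
Proof.
move=> fT; split.
- by move=> f [v _]; exact: label_schema.
- rewrite -(label_root T); apply: label_path_union; exact: on_path_root.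
- exact: closed_path_union.
Qed.

(** By induction along the path: being closed, [K] contains some result of each step, and inside the
    functional set [U P] this must be the fact that the path has added. *)
Lemma path_union_minimal P K : solution G I K -> K `<=` U P -> U P `<=` K.
Proof.
move=> [_ IK cK] KP f [v Pv]; move: f.
elim/(@tree_ind T): v Pv => [_|v u vu IHv Pu].
  by rewrite label_root; exact: IK.
have {}IHv := IHv (on_path_parent vu Pu).
have [B [f [b [br Bb ub]]]] := child_label vu.
have [b' Kb'] := branch_closed br cK IHv.
rewrite ub => g [/IHv//|/= ->]; suff -> : f b = f b' by [].
apply: (branch_unique br) (@path_union_functional P) _ (KP _ Kb').
by apply: (label_path_union Pu); rewrite ub; right.
Qed.

Lemma path_union_outcome P : fair T -> outcomes G I (U P).
Proof.
move=> fT; split; last by move=> s args [v _] /label_weight.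
split=> [|K [KP nPK] solK]; first exact: path_union_solution.
by apply: nPK; exact: path_union_minimal.
Qed.

(** Walk down the tree, always to a child whose label lies in [J]. The union of this path is a
    solution inside [J], hence equals [J] by minimality. *)
Lemma outcome_path_union J : fair T -> outcomes G I J -> exists P, U P = J.
Proof.
move=> fT [[solJ minJ] posJ]; have [_ IJ cJ] := solJ.
pose next v := if pselect (exists2 u, child v u & label u `<=` J) is left h
  then Some (projT1 (cid2 h)) else None.
pose p n := iter n (obind next) (Some (Defs.root T)).
have pJ n v : p n = Some v -> label v `<=` J.
  case: n => [[<-]|n]; first by rewrite label_root.
  rewrite /p iterS; case: (iter n _ _) => //= w.
  by rewrite /next; case: pselect => // h [<-]; case: cid2.
have pP : is_maxpath p.
  split=> // n; have -> : p n.+1 = obind next (p n) by [].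
  case pn : (p n) => [v|] //=; have vJ := pJ _ _ pn.
  rewrite /next; case: pselect => [h|h].
    by right; case: cid2 => u /= vu _; exists u.
  (* The walk stops at leaves only: at any other node [J] contains a result of the step, which has
     positive weight because [J] is an outcome, and is therefore added at some child. *)
  left; split=> //; apply: contrapT => /nonleaf_branching[B [f br]]; apply: h.
  have [b Jb] := branch_closed br cJ vJ.
  have [|b' Bb' fb'] := branch_all br (b := b).
    case: (f b) Jb => -[r|s] args Jb //=.
    exact: posJ.
  have : (L @` child v) (label v `|` [set f b']).
    by rewrite (branch_labels br); exists b'.
  case=> u vu ub; exists u => //; rewrite ub fb' => g [/vJ//|/= ->//].
exists (MaxPath pP); apply/seteqP.
have PJ : U (MaxPath pP) `<=` J by move=> f [v [n /pJ vJ]] /vJ.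
split=> //; apply: contrapT => nJP; apply: (minJ (U (MaxPath pP))) => //.
exact: path_union_solution.
Qed.

Lemma range_path_union : fair T -> range U = outcomes G I.
Proof.
move=> fT; apply/seteqP; split => [_ [P _ <-]|J /(outcome_path_union fT)[P <-]].
  exact: path_union_outcome.
by exists P.
Qed.

(** By induction every level is countable: the children of a node have distinct labels, and these
    are indexed by a countable set of branches. *)
Lemma countable_nodes : countable [set: node T].
Proof.
have -> : [set: node T] = \bigcup_n [set v | depth v = n].
  by apply/seteqP; split => // v _; exists (depth v).
apply: bigcup_countable => // n _; elim: n => [|n IHn].
  apply: (@sub_countable _ _ _ [set Defs.root T]) => //; apply: subset_card_le.
  elim/(@tree_ind T) => // v u vu _ /=; by rewrite (depth_child vu).
apply: (@sub_countable _ _ _ (\bigcup_(v in [set v | depth v = n]) child v)).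
  apply: subset_card_le; elim/(@tree_ind T) => [|v u vu _] /=.
    by rewrite depth_root.
  by rewrite (depth_child vu) => -[vn]; exists v.
apply: bigcup_countable => // v _.
case: (pselect (leaf v)) => [vl|/nonleaf_branching[B [f br]]].
  suff -> : child v = set0 by [].
  by apply/seteqP; split => // u /vl.
have : countable (L @` child v).
  rewrite (branch_labels br); apply: sub_countable (branch_countable br).
  exact: card_image_le.
move=> /countable_injP[g gi]; apply/countable_injP.
exists (g \o L) => u w /set_mem vu /set_mem vw /= uw.
by apply: (label_children vu vw); apply: gi uw; apply/mem_set; exact: imageP.
Qed.

End one_tree.
End chase.

(** * Comparison of the path measures *)

(** Serves to reindex sums and unions over a countable set by natural numbers, where the results on
    series apply. *)
Lemma countable_set_bij (I : Type) (D : set I) : countable D -> D !=set0 ->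
  exists (N : set nat) (e : nat -> I), set_bij N D e.
Proof.
move=> /countable_injP[g ginj] [i0 Di0]; exists (g @` D).
have /choice[e eP] : forall n, exists i, (g @` D) n -> D i /\ g i = n.
  move=> n; have [[i Di gi]|nn] := pselect ((g @` D) n); first by exists i.
  by exists i0.
exists e; split.
- by move=> n /eP[].
- move=> n m /set_mem/eP[_ {2}<-] /set_mem/eP[_ {2}<-] -> //.
- move=> i Di; exists (g i); first by exists i.
  have [Dei gei] : D (e (g i)) /\ g (e (g i)) = g i by apply: eP; exists i.
  by apply: ginj gei; exact/mem_set.
Qed.

Lemma ge0_esumZl (R : realType) (I : choiceType) (D : set I) (a : I -> \bar R)
    (c : R) : 0 <= c -> countable D -> (forall i, D i -> 0 <= a i)%E ->
  (\esum_(i in D) (c%:E * a i) = c%:E * \esum_(i in D) a i)%E.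
Proof.
have [->|/set0P D0] := eqVneq D set0; first by rewrite !esum_set0 mule0.
move=> c0 /countable_set_bij/(_ D0)[N [e eND]] a0; have [eN _ _] := eND.
rewrite !(reindex_esum _ _ _ _ eND) -[N]set_mem_set.
have ae0 n : n \in N -> (0 <= a (e n))%E by move=> /set_mem/eN/a0.
rewrite -!nneseries_esum// ?nneseriesZl// => n /ae0 an.
by rewrite mule_ge0.
Qed.

Lemma measure_bigcup_esum d (T : measurableType d) (R : realType)
    (mu : {measure set T -> \bar R}) (I : choiceType) (D : set I)
    (F : I -> set T) : countable D -> (forall i, D i -> measurable (F i)) ->
  trivIset D F -> (mu (\bigcup_(i in D) F i) = \esum_(i in D) mu (F i))%E.
Proof.
have [->|/set0P D0] := eqVneq D set0.
  by rewrite bigcup_set0 measure0 esum_set0.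
move=> /countable_set_bij/(_ D0)[N [e eND]] mF tF; have [eN einj esurj] := eND.
rewrite (reindex_esum _ _ _ _ eND).
have -> : \bigcup_(i in D) F i = \bigcup_(n in N) F (e n).
  apply/seteqP; split=> [x [i /esurj[n Nn <-]]|x [n /eN]]; first by exists n.
  by exists (e n).
rewrite measure_bigcup => [|n Nn|n m Nn Nm
  /(tF _ _ (eN _ Nn) (eN _ Nm))]; last first.
- exact: einj (mem_set _) (mem_set _).
- exact/mF/eN.
by rewrite nneseries_esum // set_mem_set.
Qed.

(** * Joint weights decrease on average along a chase step *)

Section facts.
Context (R : realType) (S : signature) (Delta : {fset pdist R}).
Implicit Types (F J : set (fact R (xsignature S Delta))).

(* Bounds the probability that a chase passing through a node labelled [J]
   eventually derives all the facts in [F]. *)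
Definition joint_weight F J : R :=
  if `[< functional (F `|` J) >] then set_weight (F `|` J) else 0.

Lemma joint_weight_ge0 F J : 0 <= joint_weight F J.
Proof. by rewrite /joint_weight; case: ifP => // _; exact: set_weight_ge0. Qed.

Lemma joint_weight_le F J : joint_weight F J <= set_weight (F `|` J).
Proof. by rewrite /joint_weight; case: ifP => // _; exact: set_weight_ge0. Qed.

(** The supermartingale inequality behind the backward induction. *)
Lemma branching_joint_weight (G : program S Delta) J JJ B f F :
    branching G J JJ B f -> finite_set F -> finite_set J ->
  (\esum_(b in B) (joint_weight F (J `|` [set f b]))%:E <=
   (joint_weight F J)%:E)%E.
Proof.
move=> br finF finJ; rewrite {2}/joint_weight; case: asboolP => fFJ; last first.
  (* Adding facts cannot restore functionality, so all terms vanish. *)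
  rewrite esum1// => b Bb; rewrite /joint_weight asboolF// => fFb; apply: fFJ.
  by apply: functionalS fFb => x [Fx|Jx]; [left|right; left].
have [[b Bb FJb]|nFJ] := pselect (exists2 b, B b & (F `|` J) (f b)).
  (* The fact [f b] is already in [F] or [J]: every other branch destroys functionality, and this
     one adds no factor. *)
  rewrite (esumID [set b]); last first.
    by move=> c _; rewrite lee_fin joint_weight_ge0.
  rewrite [X in (_ + X)%E]esum1 ?adde0; last first.
    move=> c [Bc /= cb]; rewrite /joint_weight asboolF// => fFc; apply: cb.
    apply: (branch_inj br) => //; apply: (branch_unique br) fFc _ _.
      by right; right.
    by case: FJb => [Fb|Jb]; [left|right; left].
  have -> : B `&` [set b] = [set b] by apply/setIidPr => _ ->.
  rewrite esum_set1 ?lee_fin ?joint_weight_ge0//.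
  rewrite (le_trans (joint_weight_le _ _))// setUA.
  by have -> : F `|` J `|` [set f b] = F `|` J by apply/setUidPl => _ ->.
(* Now every branch adds a new fact, so its term is at most the old weight times [weight (f b)], and
   these factors sum to 1. *)
apply: (@le_trans _ _
    (\esum_(b in B) ((set_weight (F `|` J))%:E * (weight (f b))%:E))%E).
  apply: le_esum => b Bb; rewrite -EFinM lee_fin.
  rewrite (le_trans (joint_weight_le _ _))// setUA set_weightU1 ?finite_setU//.
  by move=> FJb; apply: nFJ; exists b.
rewrite (@ge0_esumZl _ R B (fun b => (weight (f b))%:E)).
- by rewrite (branch_sum br) mule1.
- exact: set_weight_ge0.
- exact: branch_countable br.
- by move=> b _; rewrite lee_fin weight_ge0.
Qed.

End facts.

(** * Cylinders and the probability of deriving finitely many facts *)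

Section cylinders.
Context (R : realType) (S : signature) (Delta : {fset pdist R}).
Context (G : program S Delta) (I : set (fact R S)) (T : chase_tree G I).
Implicit Types (u v w : node T) (P Q : maxpath T).
Notation L := (@label R S Delta G I T).
Notation U := (@path_union R S Delta G I T).

Lemma measurable_cylinder v : measurable (cylinder v : set (path_space T)).
Proof. by apply: sub_sigma_algebra; exists v. Qed.

Lemma measurable_bigcup_cylinder (V : set (node T)) :
  measurable (\bigcup_(v in V) cylinder v : set (path_space T)).
Proof.
rewrite bigcup_mkcond; apply: countable_bigcupT_measurable.
  exact: countable_nodes.
by move=> v; case: ifP => // _; exact: measurable_cylinder.
Qed.

Lemma leaf_depth P v w : leaf v -> on_path P v -> on_path P w ->
  (depth w <= depth v)%N.
Proof.
move=> lv Pv; elim/(@tree_ind T): w => [|w u wu IHw] Pu.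
  by rewrite depth_root.
have Pw := on_path_parent wu Pu.
rewrite (depth_child wu) ltn_neqAle IHw// andbT; apply/eqP => wv.
by apply: (lv u); rewrite -(on_path_depth_inj Pw Pv wv).
Qed.

(** Splits a cylinder into disjoint cylinders indexed by the same set [B] over which the branch
    weights are summed. *)
Lemma children_enum v : ~ leaf v -> exists B f (u : R -> node T),
  [/\ branching G (L v) (L @` child v) B f,
      forall b, B b -> child v (u b) /\ L (u b) = L v `|` [set f b],
      forall w, child v w -> exists2 b, B b & w = u b,
      cylinder v = \bigcup_(b in B) cylinder (u b) &
      trivIset B (fun b => cylinder (u b))].
Proof.
move=> nl; have [B [f br]] := nonleaf_branching nl.
have /choice[u uB] : forall b, exists u,
    B b -> child v u /\ L u = L v `|` [set f b].
  (* Outside [B] the root is a default value. *)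
  move=> b; have [Bb|nBb] := pselect (B b); last by exists (Defs.root T).
  have [u vu ub] : (L @` child v) (L v `|` [set f b]).
    by rewrite (branch_labels br); exists b.
  by exists u.
have Bu w : child v w -> exists2 b, B b & w = u b.
  move=> vw; have [b Bb ub] : [set L v `|` [set f b] | b in B] (L w).
    by rewrite -(branch_labels br); exists w.
  have [vu uE] := uB _ Bb; exists b => //.
  by apply: (label_children vw vu); rewrite uE.
exists B, f, u; split=> //.
- rewrite cylinder_children//.
  apply/seteqP; split=> [P [w /Bu[b Bb ->]]|P [b Bb]].
    by exists b.
  by exists (u b) => //; have [] := uB _ Bb.
(* A common path forces the two children to be equal; as [f b] is not in the label of [v], it must
   be the fact [f c]. *)
- move=> b c Bb Bc [P [Pb Pc]].
  have [vb bE] := uB _ Bb; have [vc cE] := uB _ Bc.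
  have bc := on_path_child_inj vb vc Pb Pc.
  apply: (branch_inj br) => //.
  have : L (u c) (f b) by rewrite -bc bE; right.
  by rewrite cE => -[/(branch_new br)|].
Qed.

(** The event that [F] is derived within [n] levels. The depth is bounded by [n] rather than equal
    to it, so that paths ending at an earlier leaf are included. *)
Definition reached (F : set (fact R (xsignature S Delta))) n :=
  \bigcup_(v in [set v | (depth v <= n)%N /\ F `<=` L v]) cylinder v.

Lemma measurable_reached F n : measurable (reached F n : set (path_space T)).
Proof. exact: measurable_bigcup_cylinder. Qed.

Lemma path_union_reached F : finite_set F ->
  [set P | F `<=` U P] = \bigcup_n reached F n.
Proof.
move=> finF; apply/seteqP; split=> P /=.
  have /finite_seqP[s sF] := finF; rewrite sF => /path_union_seq[v Pv vs].
  by exists (depth v) => //; exists v => //=; split.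
by move=> [n _ [v [_ Fv] Pv]]; exact: subset_trans Fv (label_path_union Pv).
Qed.

Lemma measurable_path_union_sub F : finite_set F ->
  measurable ([set P | F `<=` U P] : set (path_space T)).
Proof.
move=> /path_union_reached ->; apply: bigcupT_measurable => n.
exact: measurable_reached.
Qed.

(** What a path through [v] has derived by the depth of [v] is exactly the label of [v]. *)
Lemma cylinder_reached v F :
  (cylinder v `&` reached F (depth v) = cylinder v /\ F `<=` L v) \/
  cylinder v `&` reached F (depth v) = set0.
Proof.
have [Fv|nFv] := pselect (F `<=` L v).
  left; split=> //; apply/setIidPl => P Pv; exists v => //=.
right; apply/seteqP; split=> // P [Pv [w [wv Fw] Pw]]; apply: nFv.
exact: subset_trans Fw (label_path Pw Pv wv).
Qed.

Section path_measure.
Variable pi : probability (path_space T) R.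
Hypothesis hpi : is_path_measure pi.

(** Induction on the number [k] of levels left below [v]. The event lies inside the cylinder of [v],
    so the factor P(J) is included and the bound involves no quotient. *)
Lemma reached_bound F : finite_set F -> forall k v,
  (pi (cylinder v `&` reached F (depth v + k)) <=
   (joint_weight F (L v))%:E)%E.
Proof.
move=> finF; have base v : (pi (cylinder v `&` reached F (depth v)) <=
     (joint_weight F (L v))%:E)%E.
  have [[-> Fv]|->] := cylinder_reached v F; last first.
    by rewrite measure0 lee_fin joint_weight_ge0.
  rewrite hpi /joint_weight ((setUidPr _ _).2 Fv) asboolT//.
  exact: label_functional.
elim=> [|k IHk] v; first by rewrite addn0.
have mcr w n : measurable (cylinder w `&` reached F n : set (path_space T)).
  by apply: measurableI; [exact: measurable_cylinder|exact: measurable_reached].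
have [lv|/children_enum[B [f [u [br uB Bu vu tu]]]]] := pselect (leaf v).
  (* Nothing is derived after a leaf, so its own level already decides. *)
  apply: le_trans (base v); apply: le_measure; rewrite ?inE//.
  move=> P [Pv [w [_ Fw] Pw]]; split=> //; exists w => //; split=> //.
  exact: leaf_depth Pv Pw.
(* Sum over the children, which are one level deeper and have [k] levels left. *)
rewrite vu setI_bigcupl measure_bigcup_esum.
- apply: le_trans (branching_joint_weight br finF (label_finite v)).
  apply: le_esum => b Bb; have [vb <-] := uB _ Bb.
  by have := IHk (u b); rewrite (depth_child vb) addSnnS.
- exact: branch_countable br.
- by move=> b _; exact: mcr.
- by apply: trivIset_setIr.
Qed.

(** The events [reached F n] increase to the event in question, so the uniform bound at the root
    passes to the limit. *)
Lemma path_union_bound F : finite_set F ->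
  (pi [set P | F `<=` U P] <= (joint_weight F (L (Defs.root T)))%:E)%E.
Proof.
move=> finF; rewrite path_union_reached//.
have cvp : (pi \o reached F) @ \oo --> pi (\bigcup_n reached F n).
  apply: nondecreasing_cvg_mu => [n||n m nm].
  - exact: measurable_reached.
  - by apply: bigcupT_measurable => n; exact: measurable_reached.
  apply/subsetPset => P [v [vn Fv] Pv]; exists v => //; split=> //.
  exact: leq_trans vn nm.
apply: cvge_to_le cvp _; apply: nearW => n.
have := reached_bound finF n (Defs.root T).
by rewrite depth_root cylinder_root setTI.
Qed.

End path_measure.

End cylinders.

(** * From cylinders to the whole sigma-algebra *)

Section comparison.
Context (R : realType) (S : signature) (Delta : {fset pdist R}).
Context (G : program S Delta) (I : set (fact R S)).

(** A strict inequality at a child could not be compensated by its siblings and would contradict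
    equality at the parent. *)
Lemma cylinder_le_eq (T : chase_tree G I) (pi : probability (path_space T) R)
    (nu : {measure set (path_space T) -> \bar R}) :
  (nu setT = 1)%E -> (forall v, nu (cylinder v) <= pi (cylinder v))%E ->
  forall v : node T, nu (cylinder v) = pi (cylinder v).
Proof.
move=> nu1 nupi; elim/(@tree_ind T) => [|v w vw IHv].
  by rewrite cylinder_root probability_setT.
have [B [f [u [br uB Bu vE tu]]]] := children_enum (nonleaf vw).
have [b Bb wb] := Bu _ vw.
apply/eqP; rewrite eq_le nupi/= leNgt; apply/negP => lt.
pose rest := \bigcup_(c in B `\ b) cylinder (u c).
have mw : measurable (cylinder w : set (path_space T)) := measurable_cylinder w.
have mrest : measurable (rest : set (path_space T)).
  rewrite /rest -(bigcup_image (B `\ b) u (@cylinder T)).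
  exact: measurable_bigcup_cylinder.
have vwr : cylinder v = cylinder w `|` rest.
  by rewrite vE (bigcup_setD1 b)// wb.
have dwr : cylinder w `&` rest = set0.
  apply/seteqP; split=> // P [Pw [c [Bc /= cb] Pc]]; apply: cb.
  by apply: (tu _ _ Bc Bb); exists P; split=> //; rewrite -wb.
have restE (mu : {measure set (path_space T) -> \bar R}) :
    mu rest = (\esum_(c in B `\ b) mu (cylinder (u c)))%E.
  apply: measure_bigcup_esum.
  - apply: sub_countable (branch_countable br); apply: subset_card_le.
    exact: subDsetl.
  - by move=> c _; exact: measurable_cylinder.
  - by apply: sub_trivIset tu; exact: subDsetl.
have le_rest : (nu rest <= pi rest)%E.
  by rewrite !restE; apply: le_esum => c _; exact: nupi.
have : (nu (cylinder v) < pi (cylinder v))%E.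
  rewrite vwr !measureU//; apply: lte_leD => //.
  (* Strictness survives the addition because the mass of [rest] is finite. *)
  rewrite ge0_fin_numE//; apply: le_lt_trans le_rest _.
  by apply: le_lt_trans (probability_le1 _ mrest) _; rewrite ltry.
by rewrite IHv ltxx.
Qed.

Lemma cylinder_measure_unique (T : chase_tree G I)
    (mu nu : {measure set (path_space T) -> \bar R}) :
  (mu setT < +oo)%E -> (forall v, nu (cylinder v) = mu (cylinder v)) ->
  forall A : set (path_space T), measurable A -> nu A = mu A.
Proof.
move=> mu1 numu.
(* Adding the empty set closes the cylinders under intersection without changing the generated
   sigma-algebra; the constant cover [setT] is the cylinder of the root. *)
apply: (@measure_unique _ _ (path_space T)
    (range (@cylinder T) `|` [set set0]) (fun=> setT)).
- apply/seteqP; split; apply: smallest_sub; try exact: smallest_sigma_algebra.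
    by move=> A rA; apply: sub_sigma_algebra; left.
  move=> A [[v _ <-]|->]; first exact: measurable_cylinder.
  exact: measurable0.
- move=> A B [[v _ <-]|->] [[w _ <-]|->]; rewrite ?set0I ?setI0; try by right.
  by case: (cylinderI v w) => ->; [right|left; exists v|left; exists w].
- by move=> _; left; exists (Defs.root T) => //; rewrite cylinder_root.
- by rewrite bigcup_const.
- by move=> A [[v _ <-]|->]; rewrite ?measure0.
- by move=> _; rewrite -cylinder_root numu cylinder_root.
Qed.

(** * Transport between two fair chase trees *)

Section transport.
Variables (T T' : chase_tree G I).
Hypotheses (fT : fair T) (fT' : fair T').
Notation U := (@path_union R S Delta G I T).
Notation U' := (@path_union R S Delta G I T').

Lemma preimage_cylinder (phi : path_space T' -> path_space T) (v : node T) :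
  (forall P', U (phi P') = U' P') ->
  phi @^-1` cylinder v = [set P' | label v `<=` U' P'].
Proof.
move=> phiE; apply/seteqP; split=> P'; rewrite /= -phiE; first by move/on_pathE.
by move=> h; apply/on_pathE.
Qed.

(** A path of [T'] is sent to the path of [T] with the same union, which exists because that union
    is an outcome. The preimage of a cylinder is the event of deriving a finite label. *)
Lemma path_transport : exists phi : path_space T' -> path_space T,
  (forall P', U (phi P') = U' P') /\ measurable_fun setT phi.
Proof.
have /choice[phi phiE] : forall P', exists P, U P = U' P'.
  by move=> P'; apply: outcome_path_union => //; exact: path_union_outcome.
exists phi; split=> //.
suff mG : preimage_set_system setT phi (range (@cylinder T)) `<=`
    @measurable _ (path_space T').
  exact: (@measurability _ _ (path_space T') (path_space T) _ _ _ erefl mG).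
move=> _ [_ [v _ <-] <-]; rewrite setTI.
rewrite preimage_cylinder//; apply: measurable_path_union_sub.
exact: label_finite.
Qed.

Lemma image_path_union (phi : path_space T' -> path_space T) A :
  (forall P', U (phi P') = U' P') -> U' @^-1` (U @` A) = phi @^-1` A.
Proof.
move=> phiE; apply/seteqP; split=> P' /=.
  by move=> [P AP]; rewrite -phiE => /path_union_inj <-.
by move=> AP; exists (phi P').
Qed.

Lemma events_sub A : measurable (A : set (path_space T)) ->
  exists2 A' : set (path_space T'), measurable A' & U' @` A' = U @` A.
Proof.
move=> mA; have [phi [phiE mphi]] := path_transport.
exists (phi @^-1` A); first by rewrite -[X in measurable X]setTI; exact: mphi.
rewrite -(image_path_union A phiE); apply/seteqP; split.
  exact: image_preimage_subset.
(* Surjectivity of [U'] onto the outcomes ensures that no element of the image of [A] is lost. *)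
move=> J AJ; have [P AP PJ] := AJ.
have [P' P'J] : exists P', U' P' = J.
  by apply: outcome_path_union => //; rewrite -PJ; exact: path_union_outcome.
by exists P' => //=; rewrite P'J.
Qed.

Lemma measure_transport (pi : probability (path_space T) R)
    (pi' : probability (path_space T') R) :
  is_path_measure pi -> is_path_measure pi' ->
  forall A : set (path_space T), measurable A ->
  pi' (U' @^-1` (U @` A)) = pi (U @^-1` (U @` A)).
Proof.
move=> hpi hpi' A mA; have [phi [phiE mphi]] := path_transport.
rewrite (image_path_union A phiE).
have -> : U @^-1` (U @` A) = A.
  by apply/seteqP; split=> [P [Q AQ /path_union_inj <-]|P AP] //; exists P.
(* The image of [pi'] under [phi], packaged as a measure to be compared with [pi] on the cylinders
   of [T]. *)
have [nu nuE] : exists nu : {measure set (path_space T) -> \bar R},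
    nu = pushforward pi' phi :> (set _ -> \bar R).
  by unshelve eexists (pushforward pi' phi).
transitivity (nu A); first by rewrite nuE.
apply: cylinder_measure_unique => //.
  apply: le_lt_trans (probability_le1 pi measurableT) _.
  by rewrite ltry.
apply: cylinder_le_eq => [|v]; rewrite nuE /pushforward.
  by rewrite preimage_setT probability_setT.
rewrite hpi preimage_cylinder//.
apply: le_trans (path_union_bound hpi' (label_finite v)) _.
(* Every label contains the root label, so the joint weight with the root label is at most the
   weight of [label v], the mass of its cylinder under [pi]. *)
rewrite lee_fin (le_trans (joint_weight_le _ _))// (setUidPl _ _).2//.
elim/(@tree_ind T): v => [|v u vu IHv]; first by rewrite !label_root.
exact: subset_trans IHv (label_sub vu).
Qed.

End transport.
End comparison.

Theorem theorem5p7 (R : realType) (S : signature) (Delta : {fset pdist R})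
    (G : program S Delta) (I : set (fact R S)) (hI : input_instance G I)
    (T T' : chase_tree G I) (hT : fair T) (hT' : fair T')
    (pi : probability (path_space T) R) (pi' : probability (path_space T') R)
    (hpi : is_path_measure pi) (hpi' : is_path_measure pi') :
  msample (chase_measure pi) = outcomes G I /\
  same_mspace (chase_measure pi) (chase_measure pi').
Proof.
split; first exact: range_path_union.
split.
- by rewrite /= !range_path_union.
- apply/seteqP; split=> _ [A mA <-].
    by have [A' mA' AA'] := events_sub hT hT' mA; exists A'.
  by have [A' mA' AA'] := events_sub hT' hT mA; exists A'.
- by move=> _ [A mA <-]; rewrite /= (measure_transport hT hT' hpi hpi' mA).
Qed.
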